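(* Let $k\in\mathbb{Z}^+$ and $p\in[1,\infty)$ satisfy either (1) $p\notin\mathbb{Z}$ or (2) $p\ge k$. Then there exists a $(p,k)$-isolating parallelepiped $V\in\mathbb{R}^{2^k\times k}$, $\vec t^*\in\mathbb{R}^{2^k}$. Moreover, if $p$ is computable then there is an algorithm that on input $k$ and $p$ outputs such an isolating parallelepiped.
   Context: $\|\vec x\|_p=(\sum_i|x_i|^p)^{1/p}$. For $1\le p\le\infty$ and integer $k\ge1$, $V\in\mathbb{R}^{d^*\times k}$ and $\vec t^*\in\mathbb{R}^{d^*}$ define a $(p,k)$-isolating parallelepiped if $\|V\vec x-\vec t^*\|_p=1$ for all $\vec x\in\{0,1\}^k\setminus\{\vec 0\}$ and $\|\vec t^*\|_p>1$. *)

(* Defs.v *)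
From mathcomp Require Import all_boot all_order all_algebra.
From mathcomp Require Import archimedean reals exp.

Set Implicit Arguments.
Unset Strict Implicit.
Unset Printing Implicit Defensive.

Import Order.TTheory GRing.Theory Num.Theory.
Local Open Scope ring_scope.

Definition lpnorm (R : realType) (p : R) (d : nat) (x : 'cV[R]_d) : R :=
  (\sum_(i < d) `|x i 0| `^ p) `^ p^-1.

Definition isolating_parallelepiped (R : realType) (p : R) (d k : nat)
    (V : 'M[R]_(d, k)) (t : 'cV[R]_d) : Prop :=
  (forall x : 'cV[R]_k, (forall i, x i 0 = 0 \/ x i 0 = 1) -> x != 0 ->
     lpnorm p (V *m x - t) = 1)
  /\ 1 < lpnorm p t.

(* Programs for the partial functions on the naturals that are recursive
   relative to an oracle phi : nat -> nat (Kleene's schemes).  Programs carry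
   no arity: they take a finite list of arguments, and missing arguments of
   the basic functions are read as 0. *)
Inductive prog : Type :=
| PZero
| PSucc
| PProj of nat
| POracle
| PComp of prog & seq prog
| PRec of prog & prog
| PMu of prog.

(* [eval phi c s y]: run with oracle phi on arguments s, the program c halts
   with output y. *)
Inductive eval (phi : nat -> nat) : prog -> seq nat -> nat -> Prop :=
| EvalZero s : eval phi PZero s 0%N
| EvalSucc s : eval phi PSucc s (nth 0%N s 0%N).+1
| EvalProj i s : eval phi (PProj i) s (nth 0%N s i)
| EvalOracle s : eval phi POracle s (phi (nth 0%N s 0%N))
| EvalComp f gs s ys y :
    evals phi gs s ys -> eval phi f ys y -> eval phi (PComp f gs) s y
| EvalRec0 f g s y : eval phi f s y -> eval phi (PRec f g) (0%N :: s) y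
| EvalRecS f g n s r y :
    eval phi (PRec f g) (n :: s) r -> eval phi g [:: n, r & s] y ->
    eval phi (PRec f g) (n.+1 :: s) y
| EvalMu f s n (r : nat -> nat) :
    (forall m, (m < n)%N -> eval phi f (m :: s) (r m).+1) ->
    eval phi f (n :: s) 0%N -> eval phi (PMu f) s n
with evals (phi : nat -> nat) : seq prog -> seq nat -> seq nat -> Prop :=
| EvalNil s : evals phi [::] s [::]
| EvalCons g gs s y ys :
    eval phi g s y -> evals phi gs s ys -> evals phi (g :: gs) s (y :: ys).

Scheme eval_mind := Minimality for eval Sort Prop
  with evals_mind := Minimality for evals Sort Prop.

Lemma eval_functional phi c s y z :
  eval phi c s y -> eval phi c s z -> y = z.
Proof.
move=> H; move: z.
apply: (@eval_mind phi (fun c s y => forall z, eval phi c s z -> y = z)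
  (fun gs s ys => forall zs, evals phi gs s zs -> ys = zs) _ _ _ _ _ _ _ _ _ _
  c s y H) => {c s y H}.
- by move=> s z H; inversion H.
- by move=> s z H; inversion H.
- by move=> i s z H; inversion H.
- by move=> s z H; inversion H.
- move=> f gs s ys y _ IHgs _ IHf z H.
  inversion H as [| | | |? ? ? zs ? Hgs Hf| | |]; subst.
  by apply: IHf; rewrite (IHgs _ Hgs).
- by move=> f g s y _ IHf z H; inversion H; subst; apply: IHf.
- move=> f g n s r y _ IHr _ IHg z H.
  inversion H as [| | | | | |? ? ? ? r' ? Hr Hg|]; subst.
  by apply: IHg; rewrite (IHr _ Hr).
- move=> f s n r _ IHr _ IHn z H.
  inversion H as [| | | | | | |? ? ? r' Hr Hz]; subst.
  case: (ltngtP n z) => // lt; first by have := IHn _ (Hr _ lt).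
  by have := IHr _ lt _ Hz.
- by move=> s zs H; inversion H.
- move=> g gs s y ys _ IHg _ IHgs zs H.
  inversion H as [|? ? ? ? ? Hg Hgs]; subst.
  by rewrite (IHg _ Hg) (IHgs _ Hgs).
Qed.

(* The constantly zero oracle gives no information. *)
Definition recursive (f : nat -> nat) : Prop :=
  exists c : prog, forall n, eval (fun=> 0%N) c [:: n] (f n).

(* The bijection 0, 1, 2, 3, ... |-> 0, -1, 1, -2, ... from nat to int. *)
Definition int_of_code (m : nat) : int :=
  if odd m then Negz m./2 else Posz m./2.

(* The code m denotes a dyadic rational with denominator 2 ^ n that is within
   2 ^ - n of x. *)
Definition approximates (R : realType) (n m : nat) (x : R) : Prop :=
  `|(int_of_code m)%:~R / 2 ^+ n - x| <= 2 ^- n.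

(* Dyadic Cauchy names of real numbers, as in computable analysis. *)
Definition names (R : realType) (phi : nat -> nat) (x : R) : Prop :=
  forall n, approximates n (phi n) x.

Definition computable_real (R : realType) (x : R) : Prop :=
  exists phi, recursive phi /\ names phi x.

(* With oracle phi and input k, the program c outputs the real matrix A: from
   k, the indices of an entry and a precision n it computes a dyadic
   approximation of that entry up to 2 ^ - n. *)
Definition outputs_matrix (R : realType) (c : prog) (phi : nat -> nat) (k : nat)
    (m n : nat) (A : 'M[R]_(m, n)) : Prop :=
  forall (i : 'I_m) (j : 'I_n) (prec : nat),
    exists y, eval phi c [:: k; i : nat; j : nat; prec] y
              /\ approximates prec y (A i j).

(* Main.v *)
Require Import Defs.
From mathcomp Require Import all_boot all_order all_algebra.
From mathcomp Require Import archimedean reals exp.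
From mathcomp Require Import topology normedtype.
From mathcomp Require Import derive sequences realfun.
From mathcomp Require Import ring lra.

(** Index the rows by [v < 2 ^ k] through their binary digits and put
    [V v j = 2 * (-1) ^ v_j * c_v ^ (1/p)], [t v = - (1 + 2 * |v|) * c_v ^ (1/p)].
    For [x] in [{0,1}^k] the [v]-th coordinate of [V x - t] is then
    [c_v ^ (1/p) * (1 + 2 * d(v, x))] with [d] the Hamming distance, so that
    [||V x - t||_p ^ p = \sum_v c_v * (1 + 2 * d(v, x)) ^ p] is a convolution on
    the group [(Z/2)^k].  The characters diagonalize it, and the eigenvalue at
    [S] is, up to sign, a sum of finite differences of order [|S|] of [x ^ p];
    by the mean value theorem it has the sign of [p (p-1) ... (p-|S|+1)] and
    does not vanish.  Hence the convolution can be inverted: the function equal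
    to 1 everywhere except for a small bump at [x = 0] is the image of a
    positive weight [c], given by an explicit formula in [p].

    That formula uses sums, products, inverses of positive numbers and powers
    [x ^ y] with [x, y > 0], all of which preserve computability uniformly in a
    name of [p].  Powers need neither exponential nor logarithm: a candidate
    dyadic value [z] is compared with [x ^ y], for dyadic [x] and [y], by
    raising both sides to an integer power, and a certified [z] is found by
    unbounded search. *)

Set Implicit Arguments.
Unset Strict Implicit.
Unset Printing Implicit Defensive.

Import Order.TTheory GRing.Theory Num.Theory.
Import numFieldNormedType.Exports.
Local Open Scope ring_scope.

(** * Finite differences of powers on the cube *)

Definition bit (v j : nat) : bool := odd (v %/ 2 ^ j).

(** A point of the cube is a function on all of [nat], of which only the values below [k] count:
    dropping its first coordinate is [y \o succn], just as [v./2] drops the lowest digit of a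
    code. *)
Definition hamming (k : nat) (y : nat -> bool) (v : nat) : nat :=
  \sum_(j < k) (y j (+) bit v j).

Definition weight (k v : nat) : nat := \sum_(j < k) bit v j.

(** Exponent of a character: those of [(Z/2)^k] are [y |-> (-1) ^+ dot k S y]. *)
Definition dot (k S : nat) (y : nat -> bool) : nat :=
  \sum_(j < k) (bit S j && y j).

Lemma bit0 v : bit v 0 = odd v.
Proof. by rewrite /bit expn0 divn1. Qed.

Lemma bitS v j : bit v j.+1 = bit v./2 j.
Proof. by rewrite /bit expnS divnMA divn2. Qed.

Lemma hammingS k y v :
  hamming k.+1 y v = ((y 0%N (+) odd v) + hamming k (y \o succn) v./2)%N.
Proof.
rewrite /hamming big_ord_recl bit0; congr (_ + _)%N.
by apply: eq_bigr => j _; rewrite bitS.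
Qed.

Lemma weightS k v : weight k.+1 v = (odd v + weight k v./2)%N.
Proof.
rewrite /weight big_ord_recl bit0; congr (_ + _)%N.
by apply: eq_bigr => j _; rewrite bitS.
Qed.

Lemma dotS k S y : dot k.+1 S y = ((odd S && y 0%N) + dot k S./2 (y \o succn))%N.
Proof.
rewrite /dot big_ord_recl bit0; congr (_ + _)%N.
by apply: eq_bigr => j _; rewrite bitS.
Qed.

Lemma eq_dot k S (y z : nat -> bool) : y =1 z -> dot k S y = dot k S z.
Proof. by move=> yz; apply: eq_bigr => j _; rewrite yz. Qed.

Lemma weight_leq k v : (weight k v <= k)%N.
Proof.
rewrite -[leqRHS]card_ord -sum1_card; apply: leq_sum => j _.
by case: (bit v j).
Qed.

Lemma sum_double (V : nmodType) (f : nat -> V) n :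
  \sum_(v < n.*2) f v = \sum_(v < n) (f v.*2 + f v.*2.+1).
Proof.
elim: n => [|n IH]; first by rewrite !big_ord0.
by rewrite doubleS !big_ord_recr /= IH addrA.
Qed.

Section Differences.
Variable R : realType.
Implicit Types (q x : R) (y : nat -> bool).

(* One factor [1 - T] or [1 + T] for each binary digit of [S], where [T] is
   the translation by 2, applied to the power function of exponent [q]. *)
Fixpoint pow_diff q (k S : nat) x : R :=
  if k is k'.+1 then
    pow_diff q k' S./2 x + (-1) ^+ odd S * pow_diff q k' S./2 (x + 2)
  else x `^ q.

(** Characters are eigenvectors of convolution with a function of the Hamming distance. In the
    induction, a lowest digit of [v] that agrees with [y] keeps [x] and one that differs moves it to
    [x + 2]. *)
Lemma sum_dot_hamming k S y q x :
  \sum_(v < 2 ^ k) (-1) ^+ dot k S (bit v) * (x + (2 * hamming k y v)%:R) `^ q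
  = (-1) ^+ dot k S y * pow_diff q k S x.
Proof.
elim: k S y x => [|k IH] S y x.
  by rewrite expn0 big_ord_recl big_ord0 /dot /hamming !big_ord0 muln0 !addr0.
(* [a] records whether the lowest digits of [y] and of the code differ; [v] is the rest of the
   code. *)
pose g a v := (-1) ^+ dot k S./2 (bit v) *
  (x + 2 * a%:R + (2 * hamming k (y \o succn) v)%:R) `^ q.
have IHg (a : bool) : \sum_(v < 2 ^ k) g a v =
    (-1) ^+ dot k S./2 (y \o succn) * pow_diff q k S./2 (x + 2 * a%:R).
  exact: IH.
rewrite expnS mul2n (sum_double (fun v => (-1) ^+ dot k.+1 S (bit v) *
    (x + (2 * hamming k.+1 y v)%:R) `^ q)).
transitivity (\sum_(v < 2 ^ k) (g (y 0%N) v + (-1) ^+ odd S * g (~~ y 0%N) v)).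
  apply: eq_bigr => v _.
  have half0 : (val v).*2./2 = v by rewrite doubleK.
  have half1 : (val v).*2.+1./2 = v by rewrite /= uphalf_double.
  rewrite !dotS !hammingS half0 half1 !bit0 /= odd_double /= andbF andbT addbF.
  rewrite addbT add0n /g.
  rewrite (@eq_dot _ _ (bit (val v).*2 \o succn) (bit v)); last first.
    by move=> j /=; rewrite bitS half0.
  rewrite (@eq_dot _ _ (bit (val v).*2.+1 \o succn) (bit v)); last first.
    by move=> j /=; rewrite bitS half1.
  by rewrite !natrM !natrD !mulrDr !addrA exprD mulrA.
rewrite big_split /= -big_distrr /= !IHg dotS /=.
case: (y 0%N); rewrite ?andbT ?andbF /= mulr0 mulr1 addr0 ?exprD; last ring.
by case: (odd S); rewrite ?expr0 ?expr1; ring.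
Qed.

(** The sum factors over the digits of [S]. A true [y j] makes a factor vanish, so the sum of all
    characters is supported at the origin. *)
Lemma sum_sign_dot k y :
  \sum_(S < 2 ^ k) (-1) ^+ dot k S y = \prod_(j < k) (1 + (-1) ^+ y j) :> R.
Proof.
elim: k y => [|k IH] y.
  by rewrite expn0 big_ord_recl !big_ord0 /dot big_ord0 addr0.
rewrite expnS mul2n (sum_double (fun S => (-1) ^+ dot k.+1 S y)).
rewrite big_ord_recl /= -(IH (y \o succn)) mulrDl mul1r big_distrr -big_split /=.
apply: eq_bigr => v _; rewrite !dotS /= odd_double /= doubleK uphalf_double.
by rewrite add0n exprD.
Qed.

Definition falling q (s : nat) : R := \prod_(i < s) (q - i%:R).

Lemma fallingS q s : falling q s.+1 = q * falling (q - 1) s.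
Proof.
rewrite /falling big_ord_recl subr0; congr (_ * _); apply: eq_bigr => i _.
by rewrite lift0 -natr1; ring.
Qed.

(** Differentiation commutes with translations, so it acts on the power alone. *)
Lemma is_derive_pow_diff q k S x : 0 < x ->
  is_derive x 1 (pow_diff q k S) (q * pow_diff (q - 1) k S x).
Proof.
elim: k S x => [|k IH] S x x0 /=; first exact: is_derive1_powR.
have x2 : 0 < x + 2 by rewrite addr_gt0.
have h1 := IH S./2 _ x0.
have h2 := IH S./2 _ x2.
have hs : is_derive x (1 : R) (fun z : R => z + 2) 1.
  rewrite -[X in is_derive _ _ _ X]addr0.
  exact: (is_deriveD (is_derive_id x 1) (is_derive_cst (2 : R) x 1)).
have hc := @is_derive1_comp R (pow_diff q k S./2) (fun z : R => z + 2) x _ _ h2 hs.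
have := @is_deriveD _ _ _ _ _ x 1 _ _ h1
  (@is_deriveZ _ _ _ _ ((-1) ^+ odd S) x 1 _ hc).
rewrite mulr1 /GRing.scale /= mulrCA -mulrDr; exact: id.
Qed.

(** A digit 0 of [S] adds two values of the same sign. A digit 1 takes a difference over a step of
    2, which by the mean value theorem is [- 2 * q] times a value at exponent [q - 1]. *)
Lemma pow_diff_sign k S q x : 0 < x -> falling q (weight k S) != 0 ->
  0 < (-1) ^+ weight k S * falling q (weight k S) * pow_diff q k S x.
Proof.
elim: k S q x => [|k IH] S q x x0.
  by rewrite /weight big_ord0 /falling big_ord0 !mul1r /= powR_gt0.
rewrite weightS /=; case: (odd S) => /=; last first.
  rewrite add0n expr0 mul1r mulrDr => nz.
  by rewrite addr_gt0 ?IH ?addr_gt0.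
rewrite add1n fallingS expr1 => nz.
have [q0 f0] : q != 0 /\ falling (q - 1) (weight k S./2) != 0.
  by apply/andP; rewrite -negb_or -mulf_eq0.
have lt2 : x < x + 2 by rewrite ltrDl.
have [] := @MVT R (pow_diff q k S./2) (fun z => q * pow_diff (q - 1) k S./2 z)
  _ _ lt2.
- move=> z; rewrite in_itv /= => /andP[xz _]; apply: is_derive_pow_diff.
  exact: lt_trans xz.
- apply: derivable_within_continuous => z; rewrite in_itv /= => /andP[xz _].
  by have [] := is_derive_pow_diff q k S./2 (lt_le_trans x0 xz).
move=> c; rewrite in_itv /= => /andP[xc _] E.
have c0 : 0 < c by exact: lt_trans xc.
have := IH _ _ _ c0 f0; set u := pow_diff (q - 1) _ _ c in E * => hu.
have -> : pow_diff q k S./2 x + (-1) * pow_diff q k S./2 (x + 2) = - (q * u * 2).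
  have -> : q * u * 2 = q * u * (x + 2 - x) by ring.
  by rewrite -E; ring.
rewrite exprS.
have -> : -1 * (-1) ^+ weight k S./2 * (q * falling (q - 1) (weight k S./2)) *
   (- (q * u * 2)) =
   q ^+ 2 * 2 * ((-1) ^+ weight k S./2 * falling (q - 1) (weight k S./2) * u).
  by ring.
by rewrite mulr_gt0 // mulr_gt0 // exprn_even_gt0.
Qed.

(** The roots of the falling factorial are [0, ..., s - 1]: integers, all smaller than [k]. *)
Lemma falling_neq0 q k s : q \isn't a Num.int \/ k%:R <= q -> (s <= k)%N ->
  falling q s != 0.
Proof.
move=> hq sk; apply/prodf_neq0 => i _; rewrite subr_eq0.
case: hq => [|kq]; first by apply: contraNneq => ->; rewrite intr_nat.
by rewrite gt_eqF // (lt_le_trans _ kq) // ltr_nat (leq_trans (ltn_ord i)).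
Qed.

Lemma pow_diff_neq0 k S q x : q \isn't a Num.int \/ k%:R <= q -> 0 < x ->
  pow_diff q k S x != 0.
Proof.
move=> hq x0; have /(pow_diff_sign x0) := falling_neq0 hq (weight_leq k S).
by apply: contraTneq => ->; rewrite mulr0 ltxx.
Qed.

End Differences.

(** * The isolating parallelepiped *)

Section Construction.
Variables (R : realType) (p : R) (k : nat).
Hypothesis p_ge1 : 1 <= p.
Hypothesis p_cond : p \isn't a Num.int \/ k%:R <= p.

(** Eigenvalue, at the character [S], of the convolution with [(1 + 2 * |w|) ^ p]. *)
Definition eigen (S : nat) : R :=
  \sum_(w < 2 ^ k) (-1) ^+ dot k S (bit w) * (1 + 2 * weight k w)%:R `^ p.

(* Any bound for [\sum_S `|eigen S|^-1] would do in place of this one. *)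
Definition eigen_bound : R := 1 + \sum_(S < 2 ^ k) (1 + (eigen S)^-1 ^+ 2).

(** The weight [c_v], an inverse Fourier transform. After normalization by the last factor, the
    constant [eigen_bound] produces the value 1 and the sum over [S] the bump at the origin. *)
Definition row_coef (v : nat) : R :=
  (eigen_bound + \sum_(S < 2 ^ k) (-1) ^+ dot k S (bit v) * (eigen S)^-1)
  * (eigen 0 * eigen_bound)^-1.

(** Columns [j < k] form [V] and column [k] is [t], so that one program computes both. Conditions
    are 0/1 factors and signs are differences, which keeps the first factor within arithmetic on
    [nat]. *)
Definition entry (v j : nat) : R :=
  (((j < k) * (2 * ~~ bit v j))%:R -
   ((j < k) * (2 * bit v j) + (k <= j) * (1 + 2 * weight k v))%:R)
  * row_coef v `^ p^-1.

Lemma eigenE S : eigen S = pow_diff p k S 1.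
Proof.
transitivity ((-1) ^+ dot k S (fun=> false) * pow_diff p k S 1); last first.
  by rewrite /dot big1 ?mul1r // => j _; rewrite andbF.
rewrite -sum_dot_hamming; apply: eq_bigr => v _; rewrite natrD; congr (_ * _).
Qed.

Lemma eigen_neq0 S : eigen S != 0.
Proof. by rewrite eigenE pow_diff_neq0. Qed.

Lemma dot0 y : dot k 0 y = 0%N.
Proof. by apply: big1 => j _; rewrite /bit div0n. Qed.

Lemma eigen0_gt0 : 0 < eigen 0.
Proof.
rewrite lt_neqAle eq_sym eigen_neq0; apply: sumr_ge0 => w _.
by rewrite dot0 mul1r powR_ge0.
Qed.

Lemma eigen_bound_gt0 : 0 < eigen_bound.
Proof.
by apply: ltr_pwDl => //; apply: sumr_ge0 => S _; rewrite addr_ge0 ?sqr_ge0.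
Qed.

(** With [u] the inverse eigenvalue, each [S] contributes [1 + u ^ 2 + u] or [1 + u ^ 2 - u], both
    nonnegative; the leading 1 of [eigen_bound] gives strictness. *)
Lemma row_coef_gt0 v : 0 < row_coef v.
Proof.
rewrite mulr_gt0 ?invr_gt0 ?mulr_gt0 ?eigen0_gt0 ?eigen_bound_gt0 //.
rewrite /eigen_bound -addrA ltr_pwDl // -big_split /=.
apply: sumr_ge0 => S _; set u := _^-1.
by rewrite -signr_odd; case: (odd _); rewrite ?expr0 ?expr1; nra.
Qed.

(** Convolution multiplies the constant part of the weight by [eigen 0] and the character at [S] by
    [eigen S], which cancels its coefficient; the characters then add up to the product. *)
Lemma sum_row_coef y :
  \sum_(v < 2 ^ k) row_coef v * (1 + 2 * hamming k y v)%:R `^ p =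
  1 + (\prod_(j < k) (1 + (-1) ^+ y j)) / (eigen 0 * eigen_bound).
Proof.
have nz : eigen 0 * eigen_bound != 0.
  by rewrite lt0r_neq0 // mulr_gt0 ?eigen0_gt0 ?eigen_bound_gt0.
have conv S : \sum_(v < 2 ^ k) (-1) ^+ dot k S (bit v) *
    (1 + 2 * hamming k y v)%:R `^ p = (-1) ^+ dot k S y * eigen S.
  by rewrite eigenE -sum_dot_hamming; apply: eq_bigr => v _; rewrite natrD.
have conv0 : \sum_(v < 2 ^ k) (1 + 2 * hamming k y v)%:R `^ p = eigen 0.
  have := conv 0%N; rewrite dot0 mul1r => <-.
  by apply: eq_bigr => v _; rewrite dot0 mul1r.
transitivity ((eigen_bound * eigen 0 + \sum_(S < 2 ^ k) (eigen S)^-1 *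
    ((-1) ^+ dot k S y * eigen S)) / (eigen 0 * eigen_bound)).
  rewrite -conv0 big_distrr /=.
  under [X in _ + X]eq_bigr => S _ do rewrite -conv big_distrr /=.
  rewrite exchange_big /= -big_split big_distrl /=.
  apply: eq_bigr => v _; rewrite /row_coef -conv0 mulrAC; congr (_ / _).
  rewrite mulrDl big_distrl /=; congr (_ + _); apply: eq_bigr => S _.
  by rewrite mulrA [_^-1 * _]mulrC.
rewrite mulrDl [eigen_bound * _]mulrC divff // -sum_sign_dot; congr (_ + _ / _).
by apply: eq_bigr => S _; rewrite mulrCA mulVf ?mulr1 ?eigen_neq0.
Qed.

Definition parallelepiped : 'M[R]_(2 ^ k, k) := \matrix_(i, j) entry i j.

Definition target : 'cV[R]_(2 ^ k) := \col_i entry i k.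

Lemma row_mx_entry i (j : 'I_(k + 1)) : row_mx parallelepiped target i j = entry i j.
Proof.
rewrite mxE; case: splitP => l jl; rewrite mxE jl //.
by rewrite ord1 addn0.
Qed.

Lemma parallelepiped_mul (x : 'cV[R]_k) (y : nat -> bool) :
  (forall j : 'I_k, x j 0 = (y j)%:R) -> forall i,
  (parallelepiped *m x - target) i 0 =
  row_coef i `^ p^-1 * (1 + 2 * hamming k y i)%:R.
Proof.
move=> xy i; rewrite !mxE /entry ltnn leqnn !mul0n !mul1n add0n sub0r mulNr opprK.
have E n : (1 + 2 * n)%:R = 1 + 2 * n%:R :> R by rewrite natrD natrM.
rewrite [RHS]mulrC !E /hamming /weight [in RHS]raddf_sum [in LHS]raddf_sum /=.
under eq_bigr => j _ do
  rewrite mxE xy /entry ltn_ord leqNgt ltn_ord mul1n mul0n addn0 mulrAC.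
rewrite -big_distrl -mulrDl; congr (_ * _) => /=.
rewrite !mulr_sumr addrCA -big_split /=; congr (1 + _); apply: eq_bigr => j _.
(* A digit [b] of the row contributes [2 * (1 - 2 * b) * y_j + 2 * b], twice the exclusive or of
   [y_j] and [b]. *)
by case: (y j); case: (bit i j); rewrite /= ?muln0 ?muln1; ring.
Qed.

Lemma lpnorm_parallelepiped (x : 'cV[R]_k) (y : nat -> bool) :
  (forall j : 'I_k, x j 0 = (y j)%:R) ->
  lpnorm p (parallelepiped *m x - target) =
  (1 + (\prod_(j < k) (1 + (-1) ^+ y j)) / (eigen 0 * eigen_bound)) `^ p^-1.
Proof.
move=> xy; rewrite /lpnorm -sum_row_coef; congr (_ `^ _); apply: eq_bigr => i _.
have p0 : p != 0 by rewrite gt_eqF // (lt_le_trans _ p_ge1).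
rewrite (parallelepiped_mul xy) ger0_norm ?mulr_ge0 ?powR_ge0 //.
by rewrite powRM ?powR_ge0 // -powRrM mulVf // powRr1 // ltW ?row_coef_gt0.
Qed.

(** For [x != 0] some factor [1 + (-1) ^+ y j] is zero and the norm is 1; at [x = 0] the product is
    positive and the norm exceeds 1. *)
Lemma isolating_parallelepiped_entry : isolating_parallelepiped p parallelepiped target.
Proof.
split=> [x x01 xn0|].
  pose y n := oapp (fun i : 'I_k => x i 0 == 1) false (insub n).
  have xy (j : 'I_k) : x j 0 = (y j)%:R.
    rewrite /y valK /=; case: (x01 j) => ->; rewrite ?eqxx //.
    by rewrite eq_sym oner_eq0.
  have [j yj] : exists j : 'I_k, y j.
    apply/existsP; apply: contraNT xn0 => /existsPn y0.
    by apply/eqP/matrixP => j l; rewrite ord1 xy (negbTE (y0 j)) mxE.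
  by rewrite (lpnorm_parallelepiped xy) (bigD1 j) //= yj subrr !mul0r addr0 powR1.
have x0 (j : 'I_k) : (0 : 'cV[R]_k) j 0 = false%:R by rewrite mxE.
(* [- t] is the value of [V x - t] at [x = 0], and the norm ignores the sign. *)
have -> : lpnorm p target = lpnorm p (parallelepiped *m 0 - target).
  rewrite mulmx0 sub0r /lpnorm; congr (_ `^ _).
  by apply: eq_bigr => i _; rewrite !mxE normrN.
rewrite (lpnorm_parallelepiped (y := fun=> false) x0).
have D0 : 0 < (\prod_(j < k) (1 + (-1) ^+ false)) / (eigen 0 * eigen_bound).
  rewrite divr_gt0 ?mulr_gt0 ?eigen0_gt0 ?eigen_bound_gt0 //.
  by apply: prodr_gt0 => j _; rewrite expr0 addr_gt0.
have one : 1 = 1 `^ p^-1 :> R by rewrite powR1.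
rewrite [ltLHS]one; apply: gt0_ltr_powR; rewrite ?nnegrE ?ltrDl //.
  by rewrite invr_gt0 (lt_le_trans _ p_ge1).
by rewrite addr_ge0 // ltW.
Qed.

End Construction.

(** * Oracle computability on the naturals *)

Section Computability.
Variables (E : Type) (oracle : E -> nat -> nat) (par : E -> nat).
Local Open Scope nat_scope.
Implicit Types (f g h : E -> seq nat -> nat) (P Q : E -> seq nat -> bool).

(* Uniformity in [e : E] is the point: one program works for all oracles.  The
   parameter [par e] is passed after the [n] variables in [s], so that binding
   a new variable is consing it to [s]. *)
Definition computable n f := exists c : prog, forall e s, size s = n ->
  Defs.eval (oracle e) c (rcons s (par e)) (f e s).

Lemma eq_computable n f g : (forall e s, size s = n -> f e s = g e s) ->
  computable n f -> computable n g.
Proof. by move=> fg [c hc]; exists c => e s ss; rewrite -fg //; apply: hc. Qed.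

Lemma computable_var n i : i < n -> computable n (fun e s => nth 0 s i).
Proof.
move=> lt_in; exists (PProj i) => e s ss.
have -> : nth 0 s i = nth 0 (rcons s (par e)) i by rewrite nth_rcons ss lt_in.
exact: EvalProj.
Qed.

Lemma computable_par n : computable n (fun e s => par e).
Proof.
exists (PProj n) => e s ss.
have := @EvalProj (oracle e) n (rcons s (par e)).
by rewrite nth_rcons ss ltnn eqxx.
Qed.

(** The parameter must again follow the arguments of [f], so it is recomputed as one more argument
    at the end. *)
Lemma computable_subst n f (gs : seq (E -> seq nat -> nat)) :
  computable (size gs) f ->
  foldr (fun g => and (computable n g)) True gs ->
  computable n (fun e s => f e [seq g e s | g <- gs]).
Proof.
move=> [c hc] hgs.
have [cs hcs] : exists cs, forall e s, size s = n ->
    evals (oracle e) cs (rcons s (par e)) (rcons [seq g e s | g <- gs] (par e)).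
  elim: gs hgs {hc} => [_|g gs IH [[d hd] /IH [cs hcs]]] /=.
    have [d hd] := computable_par n.
    by exists [:: d] => e s ss; apply: EvalCons (EvalNil _ _); apply: hd.
  by exists (d :: cs) => e s ss; apply: EvalCons; [apply: hd | apply: hcs].
exists (PComp c cs) => e s ss; apply: EvalComp (hcs e s ss) _.
by apply: hc; rewrite size_map.
Qed.

(** Weakening under binders: the [j] most recent variables are dropped and the values of [hs], which
    may still use them, take their place. *)
Lemma computable_env j n f (hs : seq (E -> seq nat -> nat)) :
  computable (size hs + n) f ->
  foldr (fun h => and (computable (j + n) h)) True hs ->
  computable (j + n) (fun e s => f e ([seq h e s | h <- hs] ++ iter j behead s)).
Proof.
move=> hf hhs; pose vs : seq (E -> seq nat -> nat) :=
  [seq (fun _ s => nth 0 s i) | i <- iota j n].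
have := @computable_subst (j + n) f (hs ++ vs).
rewrite size_cat size_map size_iota => /(_ hf) H.
apply: eq_computable (H _) => [e s ss|{H}].
  congr (f e _); rewrite map_cat -map_comp -drop_behead; congr (_ ++ _).
  rewrite (@map_nth_iota _ 0 s j n) ?ss ?addKn // take_oversize //.
  by rewrite size_drop ss addKn.
elim: hs hhs {hf} => [_|h hs IH [hh /IH]] //=.
have : all (gtn (j + n)) (iota j n).
  by apply/allP => i; rewrite mem_iota => /andP[].
rewrite /vs; elim: (iota j n) => //= i r IH /andP[lt_in /IH].
by split; first exact: computable_var.
Qed.

Lemma computable_behead n f : computable n f ->
  computable n.+1 (fun e s => f e (behead s)).
Proof. by move=> hf; exact: (@computable_env 1 n f [::]). Qed.

Lemma computable_rec n f g N : computable n f -> computable n.+2 g ->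
  computable n N ->
  computable n
    (fun e s => iteri (N e s) (fun i r => g e [:: i, r & s]) (f e s)).
Proof.
move=> [c hc] [d hd] [b hb].
exists (PComp (PRec c d) (b :: [seq PProj i | i <- iota 0 n.+1])) => e s ss.
apply: (@EvalComp _ _ _ _ (N e s :: rcons s (par e))).
  apply: EvalCons; first exact: hb.
  have {2}-> : rcons s (par e) = [seq nth 0 (rcons s (par e)) i | i <- iota 0 n.+1].
    by rewrite -ss -(size_rcons s (par e)) map_nth_iota0 // take_size.
  elim: (iota 0 n.+1) => [|i r IH] /=; first exact: EvalNil.
  by apply: EvalCons IH; apply: EvalProj.
elim: (N e s) => [|m IH] /=; first by apply: EvalRec0; apply: hc.
by apply: EvalRecS IH _; rewrite -!rcons_cons; apply: hd; rewrite /= ss.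
Qed.

(** * Arithmetic and bounded quantification *)

Lemma computable_succ n f : computable n f -> computable n (fun e s => (f e s).+1).
Proof.
move=> [c hc]; exists (PComp PSucc [:: c]) => e s ss.
apply: (@EvalComp _ _ _ _ [:: f e s]); last exact: EvalSucc.
by apply: EvalCons (EvalNil _ _); apply: hc.
Qed.

Lemma computable_const n m : computable n (fun _ _ => m).
Proof.
elim: m => [|m IH]; last exact: computable_succ.
by exists PZero => e s _; apply: EvalZero.
Qed.

Lemma computable_oracle n f :
  computable n f -> computable n (fun e s => oracle e (f e s)).
Proof.
move=> [c hc]; exists (PComp POracle [:: c]) => e s ss.
apply: (@EvalComp _ _ _ _ [:: f e s]); last exact: EvalOracle.
by apply: EvalCons (EvalNil _ _); apply: hc.
Qed.

Lemma computable_add n f g : computable n f -> computable n g ->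
  computable n (fun e s => f e s + g e s).
Proof.
move=> hf hg; have hstep : computable n.+2 (fun e s => (nth 0 s 1).+1).
  exact/computable_succ/computable_var.
apply: eq_computable (computable_rec hf hstep hg) => e s _ /=.
by elim: (g e s) => [|m IH] /=; rewrite ?addn0 // IH addnS.
Qed.

Lemma computable_mul n f g : computable n f -> computable n g ->
  computable n (fun e s => f e s * g e s).
Proof.
move=> hf hg.
have hstep : computable n.+2 (fun e s => f e (behead (behead s)) + nth 0 s 1).
  by apply: computable_add; [exact: (@computable_env 2 n f [::]) | exact: computable_var].
apply: eq_computable (computable_rec (computable_const n 0) hstep hg) => e s _ /=.
by elim: (g e s) => [|m IH] /=; rewrite ?muln0 // IH mulnS.
Qed.

Lemma computable_exp n f g : computable n f -> computable n g ->
  computable n (fun e s => f e s ^ g e s).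
Proof.
move=> hf hg.
have hstep : computable n.+2 (fun e s => f e (behead (behead s)) * nth 0 s 1).
  by apply: computable_mul; [exact: (@computable_env 2 n f [::]) | exact: computable_var].
apply: eq_computable (computable_rec (computable_const n 1) hstep hg) => e s _ /=.
by elim: (g e s) => [|m IH] /=; rewrite ?expn0 // IH expnS.
Qed.

Lemma computable_pred n f : computable n f -> computable n (fun e s => (f e s).-1).
Proof.
move=> hf; have hstep : computable n.+2 (fun e s => nth 0 s 0).
  exact: computable_var.
apply: eq_computable (computable_rec (computable_const n 0) hstep hf) => e s _ /=.
by case: (f e s).
Qed.

Lemma computable_sub n f g : computable n f -> computable n g ->
  computable n (fun e s => f e s - g e s).
Proof.
move=> hf hg; have hstep : computable n.+2 (fun e s => (nth 0 s 1).-1).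
  exact/computable_pred/computable_var.
apply: eq_computable (computable_rec hf hstep hg) => e s _ /=.
by elim: (g e s) => [|m IH] /=; rewrite ?subn0 // IH subnS.
Qed.

Lemma computable_leq n f g : computable n f -> computable n g ->
  computable n (fun e s => f e s <= g e s).
Proof.
move=> hf hg; have := computable_sub (computable_const n 1) (computable_sub hf hg).
by apply: eq_computable => e s _; rewrite -[_ <= _]subn_eq0; case: (_ - g e s).
Qed.

Lemma computable_neg n P : computable n (fun e s => P e s) ->
  computable n (fun e s => ~~ P e s).
Proof.
move=> hP; have := computable_sub (computable_const n 1) hP.
by apply: eq_computable => e s _; case: (P e s).
Qed.

Lemma computable_and n P Q : computable n (fun e s => P e s) ->
  computable n (fun e s => Q e s) -> computable n (fun e s => P e s && Q e s).
Proof.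
move=> hP hQ; apply: eq_computable (computable_mul hP hQ) => e s _.
by rewrite mulnb.
Qed.

Lemma computable_sum n f N : computable n N -> computable n.+1 f ->
  computable n (fun e s => \sum_(i < N e s) f e (val i :: s)).
Proof.
move=> hN hf.
have hstep : computable n.+2
    (fun e s => nth 0 s 1 + f e (nth 0 s 0 :: behead (behead s))).
  apply: computable_add; first exact: computable_var.
  apply: (@computable_env 2 n f [:: fun _ s => nth 0 s 0]) => //.
  by split=> //; exact: computable_var.
apply: eq_computable (computable_rec (computable_const n 0) hstep hN) => e s _ /=.
elim: (N e s) => [|m IH] /=; first by rewrite big_ord0.
by rewrite big_ord_recr /= IH.
Qed.

Lemma computable_bex n P N : computable n N ->
  computable n.+1 (fun e s => P e s) ->
  computable n (fun e s => [exists i : 'I_(N e s), P e (val i :: s)]).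
Proof.
move=> hN hP.
have := computable_leq (computable_const n 1) (computable_sum hN hP).
apply: eq_computable => e s _; congr (nat_of_bool _).
rewrite lt0n sum_nat_eq0 negb_forall; apply: eq_existsb => i /=.
by rewrite eqb0 negbK.
Qed.

(** The quotient counts the [i < f] with [(i + 1) * g <= f]; the factor [1 <= g] yields the value 0
    for [g = 0]. *)
Lemma computable_div n f g : computable n f -> computable n g ->
  computable n (fun e s => f e s %/ g e s).
Proof.
move=> hf hg.
have hP : computable n.+1
    (fun e s => (nth 0 s 0).+1 * g e (behead s) <= f e (behead s)).
  apply: computable_leq; last exact: computable_behead.
  apply: computable_mul; last exact: computable_behead.
  exact/computable_succ/computable_var.
have := computable_mul (computable_leq (computable_const n 1) hg)
                       (computable_sum hf hP).
apply: eq_computable => e s _ /=.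
have [|g0] := posnP (g e s); first by move=> ->; rewrite divn0.
rewrite mul1n; under eq_bigr => i _ do rewrite -leq_divRL //.
have : f e s %/ g e s <= f e s by exact: leq_div.
move: (f e s) (f e s %/ _) => m q qm.
elim: m q qm => [|m IH] [|q] // qm; first by rewrite big_ord0.
  by rewrite big1.
by rewrite big_ord_recl /= IH.
Qed.

Lemma computable_odd n f : computable n f -> computable n (fun e s => odd (f e s)).
Proof.
move=> hf; have h2 := computable_const n 2.
have := computable_sub hf (computable_mul (computable_div hf h2) h2).
apply: eq_computable => e s _; rewrite -modn2.
by rewrite {1}(divn_eq (f e s) 2) addKn.
Qed.

(** * Unbounded search *)

Lemma computable_mu n P : computable n.+1 (fun e s => P e s) ->
  (forall e s, size s = n -> exists m, P e (m :: s)) ->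
  exists2 g, computable n g & forall e s, size s = n -> P e (g e s :: s).
Proof.
move=> hP exP.
exists (fun e s => if size s =P n is ReflectT ss then ex_minn (exP e s ss) else 0).
  (* [PMu] seeks a zero, and the negated test is 0 exactly where [P] holds. *)
  have [c hc] := computable_neg hP; exists (PMu c) => e s ss.
  case: eqP => // ss'; case: ex_minnP => m Pm minm.
  apply: (@EvalMu _ _ _ _ (fun=> 0)) => [i lt_im|].
    have := hc e (i :: s); rewrite /= ss => /(_ erefl).
    by have -> // : P e (i :: s) = false by apply/negP => /minm; rewrite leqNgt lt_im.
  by have := hc e (m :: s); rewrite /= ss Pm; apply.
by move=> e s ss; case: eqP => // ss'; case: ex_minnP.
Qed.

(** Two minimizations in a row: first a bound below which some pair exists, then a [z] that has a
    witness [w] below that bound. *)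
Lemma computable_search n P : computable n.+2 (fun e s => P e s) ->
  (forall e s, size s = n -> exists z w, P e [:: w, z & s]) ->
  exists2 g, computable n g & forall e s, size s = n -> exists w, P e [:: w, g e s & s].
Proof.
move=> hP exP.
pose B2 e s := [exists w : 'I_(nth 0 s 1), P e [:: val w, nth 0 s 0 & behead (behead s)]].
have hB2 : computable n.+2 (fun e s => B2 e s).
  apply: (@computable_bex n.+2
    (fun e s => P e (nth 0 s 0 :: nth 0 s 1 :: behead (behead (behead s))))).
    exact: computable_var.
  apply: (@computable_env 3 n (fun e s => P e s)
    [:: fun _ s => nth 0 s 0; fun _ s => nth 0 s 1]) => //.
  by do 2![split; first exact: computable_var].
pose B1 e s := [exists z : 'I_(nth 0 s 0), B2 e [:: val z, nth 0 s 0 & behead s]].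
have hB1 : computable n.+1 (fun e s => B1 e s).
  apply: (@computable_bex n.+1
    (fun e s => B2 e (nth 0 s 0 :: nth 0 s 1 :: behead (behead s)))).
    exact: computable_var.
  by apply: eq_computable hB2 => e [|a [|b s]].
have [|b hb Pb] := computable_mu hB1.
  move=> e s ss; have [z [w Pzw]] := exP e s ss; exists (maxn z w).+1.
  apply/existsP; exists (inord z) => /=; apply/existsP; exists (inord w) => /=.
  by rewrite !inordK ?ltnS ?leq_maxl ?leq_maxr.
have hT : computable n.+1 (fun e s => B2 e [:: nth 0 s 0, b e (behead s) & behead s]).
  apply: (@computable_env 1 n (fun e s => B2 e s)
    [:: fun _ s => nth 0 s 0; fun e s => b e (behead s)]) => //.
  split; first exact: computable_var.
  by split=> //; exact: computable_behead.
have [|g hg Pg] := computable_mu hT.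
  move=> e s ss; have : B1 e (b e s :: s) by exact: Pb.
  by case/existsP => z Hz; exists z.
exists g => // e s ss; move: (Pg e s ss) => /existsP[[w ltw] /= Pw].
by exists w.
Qed.

End Computability.

(** * Computable real-valued functions *)

Ltac computability :=
  repeat first
    [ assumption | exact: computable_const | exact: computable_par
    | by apply: computable_var | apply: computable_oracle
    | apply: computable_exp | apply: computable_mul | apply: computable_add
    | apply: computable_sub | apply: computable_div
    | apply: computable_succ | apply: computable_pred | apply: computable_leq
    | apply: computable_and | apply: computable_neg | apply: computable_odd
    | apply: computable_behead ].

Section ComputableReals.
Local Open Scope classical_set_scope.
Local Open Scope ring_scope.
Variables (R : realType) (E : Type) (oracle : E -> nat -> nat) (par : E -> nat).
Implicit Types (X Y : E -> seq nat -> R) (a b d f : E -> seq nat -> nat).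

Local Notation computable := (computable oracle par).

(** A difference of two natural numbers within 1 of [2 ^ m * X] spares a coding of integers; the
    precision [m] is the first variable. *)
Definition computable_fun n X := exists a b,
  [/\ computable n.+1 a, computable n.+1 b & forall e s m, size s = n ->
      `|(a e (m :: s))%:R - (b e (m :: s))%:R - 2 ^+ m * X e s| <= 1].

Lemma eq_computable_fun n X Y : (forall e s, size s = n -> X e s = Y e s) ->
  computable_fun n X -> computable_fun n Y.
Proof.
move=> XY [a [b [ha hb hX]]]; exists a, b; split=> // e s m ss.
by rewrite -XY // hX.
Qed.

(** The quotient is [N / d] rounded to the nearest integer; its error bound 1/2 is multiplied by
    [2 * d]. *)
Lemma divn_nearest (N d : nat) : (0 < d)%N ->
  `|2 * d%:R * ((2 * N + d) %/ (2 * d))%:R - 2 * N%:R| <= d%:R :> R.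
Proof.
move=> d0; have d2 : (0 < 2 * d)%N by rewrite muln_gt0.
have e1 := divn_eq (2 * N + d) (2 * d); have := ltn_pmod (2 * N + d) d2.
move: e1; set q := (_ %/ _)%N; set r := (_ %% _)%N => e1 r2.
have {}e1 : 2 * N%:R + d%:R = q%:R * (2 * d%:R) + r%:R :> R.
  by rewrite -!natrM -!natrD e1.
have {}r2 : r%:R <= 2 * d%:R :> R by rewrite -natrM ler_nat ltnW.
have r0 : 0 <= r%:R :> R by [].
by rewrite ler_norml; apply/andP; split; lra.
Qed.

(** A fraction [(a - b) / d] within [2 ^ - (m + 1)] of [X] is rounded to a multiple of [2 ^ - m];
    each of the two errors costs at most 1/2 at the scale [2 ^ m]. *)
Lemma computable_fun_round n X a b d :
  computable n.+1 a -> computable n.+1 b -> computable n.+1 d ->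
  (forall e s m, size s = n -> (0 < d e (m :: s))%N /\
    `|(a e (m :: s))%:R - (b e (m :: s))%:R - (d e (m :: s))%:R * X e s|
      * 2 ^+ m.+1 <= (d e (m :: s))%:R) ->
  computable_fun n X.
Proof.
move=> ha hb hd H.
exists (fun e s => (2 * (2 ^ nth 0 s 0 * (a e s - b e s)) + d e s) %/ (2 * d e s))%N.
exists (fun e s => (2 * (2 ^ nth 0 s 0 * (b e s - a e s)) + d e s) %/ (2 * d e s))%N.
split; [by computability | by computability | move=> e s m ss /=].
have [] := H e s m ss; move: (a e _) (b e _) (d e _) (X e s) => {H} A B D x D0 H.
have D0' : 0 < D%:R :> R by rewrite ltr0n.
(* One of the two truncated differences is 0, and its quotient is then [d %/ (2 * d) = 0]. *)
have small : ((2 * (2 ^ m * 0) + D) %/ (2 * D) = 0)%N.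
  by rewrite !muln0 add0n divn_small // ltn_Pmull.
set q1 := (_ %/ _)%N; set q2 := (_ %/ _)%N.
have : `|2 * D%:R * (q1%:R - q2%:R) - 2 * (2 ^+ m * (A%:R - B%:R))| <= D%:R :> R.
  rewrite /q1 /q2; have [le_BA|/ltnW le_AB] := leqP B A.
    have -> : (B - A = 0)%N by apply/eqP; rewrite subn_eq0.
    have -> : 2 ^+ m * (A%:R - B%:R) = (2 ^ m * (A - B))%:R :> R.
      by rewrite natrM natrX natrB.
    by rewrite small subr0; exact: divn_nearest.
  have -> : (A - B = 0)%N by apply/eqP; rewrite subn_eq0.
  have -> : 2 ^+ m * (A%:R - B%:R) = - (2 ^ m * (B - A))%:R :> R.
    by rewrite natrM natrX natrB // -mulrN opprB.
  by rewrite small sub0r !mulrN -opprD normrN; exact: divn_nearest.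
move: (q1%:R - q2%:R) H; rewrite exprS; have : 0 < 2 ^+ m :> R by rewrite exprn_gt0.
move: (2 ^+ m) (A%:R - B%:R) => M F M0 q H1 H2.
rewrite -(ler_pM2l (_ : 0 < 2 * D%:R)) ?mulr_gt0 // mulr1.
rewrite -[X in X * `|_| <= _]gtr0_norm ?mulr_gt0 // -normrM.
have -> : 2 * D%:R * (q - M * x) =
  (2 * D%:R * q - 2 * (M * F)) + 2 * M * (F - D%:R * x) by ring.
apply: le_trans (ler_normD _ _) _.
rewrite normrM (gtr0_norm (_ : 0 < 2 * M)) ?mulr_gt0 //; lra.
Qed.

(** * Sums and products *)

Lemma computable_fun_opp n X : computable_fun n X ->
  computable_fun n (fun e s => - X e s).
Proof.
move=> [a [b [ha hb hX]]]; exists b, a; split=> // e s m ss.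
by rewrite mulrN opprK -normrN opprD opprB; apply: hX.
Qed.

Lemma computable_fun_nat n f : computable n f ->
  computable_fun n (fun e s => (f e s)%:R).
Proof.
move=> hf; exists (fun e s => 2 ^ nth 0 s 0 * f e (behead s))%N, (fun _ _ => 0%N).
split; [by computability.. | move=> e s m ss /=].
by rewrite natrM natrX subr0 subrr normr0.
Qed.

Lemma computable_prec n f (h : E -> seq nat -> nat) :
  computable n.+1 f -> computable n.+1 h ->
  computable n.+1 (fun e s => f e (h e s :: behead s)).
Proof. by move=> hf hh; apply: (@computable_env _ _ _ 1 n f [:: h]). Qed.

Lemma computable_fun_add n X Y : computable_fun n X -> computable_fun n Y ->
  computable_fun n (fun e s => X e s + Y e s).
Proof.
move=> [a [b [ha hb hX]]] [c [d [hc hd hY]]].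
(* Two errors [2 ^ - (m + 2)] add up to the [2 ^ - (m + 1)] allowed before rounding. *)
have hp : computable n.+1 (fun e s => (nth 0 s 0 + 2)%N) by computability.
apply: (@computable_fun_round _ _
  (fun e s => a e (nth 0 s 0 + 2 :: behead s) + c e (nth 0 s 0 + 2 :: behead s))%N
  (fun e s => b e (nth 0 s 0 + 2 :: behead s) + d e (nth 0 s 0 + 2 :: behead s))%N
  (fun e s => 2 ^ (nth 0 s 0 + 2))%N).
- by apply: computable_add; exact: computable_prec hp.
- by apply: computable_add; exact: computable_prec hp.
- by computability.
move=> e s m ss /=; split; first by rewrite expn_gt0.
have := hX e s (m + 2)%N ss; have := hY e s (m + 2)%N ss.
rewrite !natrD natrX; move: (a e _)%:R (b e _)%:R (c e _)%:R (d e _)%:R.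
move=> A B C D; move: (X e s) (Y e s) => x y.
have -> : 2 ^+ (m + 2) = 2 * 2 ^+ m.+1 :> R by rewrite addn2 [in LHS]exprS.
have : 0 < 2 ^+ m.+1 :> R by rewrite exprn_gt0.
move: (2 ^+ m.+1) => M M0 H1 H2; rewrite ler_pM2r //.
have -> : A + C - (B + D) - 2 * M * (x + y) =
  (A - B - 2 * M * x) + (C - D - 2 * M * y) by ring.
by apply: le_trans (ler_normD _ _) _; lra.
Qed.

Lemma natr_le_exp2 (B : nat) : B%:R <= 2 ^+ B :> R.
Proof. by rewrite -natrX ler_nat ltnW // ltn_expl. Qed.

Lemma approx_mul (x y u v T B : R) : 1 <= T ->
  `|u - T * x| <= 1 -> `|v - T * y| <= 1 -> `|x| + `|y| + 1 <= B ->
  `|u * v - T * T * (x * y)| <= T * B.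
Proof.
move=> T1 hu hv hB.
have -> : u * v - T * T * (x * y) =
  (u - T * x) * (v - T * y) + T * (x * (v - T * y) + y * (u - T * x)) by ring.
have T0 : 0 <= T by lra.
apply: le_trans (ler_normD _ _) _.
have : `|(u - T * x) * (v - T * y)| <= 1 by rewrite normrM mulr_ile1.
have : `|T * (x * (v - T * y) + y * (u - T * x))| <= T * (`|x| + `|y|).
  rewrite normrM (ger0_norm T0) ler_wpM2l //.
  by apply: le_trans (ler_normD _ _) _; rewrite !normrM lerD // ler_piMr.
by nra.
Qed.

Lemma computable_fun_mul n X Y : computable_fun n X -> computable_fun n Y ->
  computable_fun n (fun e s => X e s * Y e s).
Proof.
move=> [a [b [ha hb hX]]] [c [d [hc hd hY]]].
(* Approximations at precision 0 bound [|X|] by [a + b + 1] and [|Y|] by [c + d + 1], hence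
   [|X| + |Y| + 1] by [bnd]. *)
pose bnd e s := (a e (0 :: behead s) + b e (0 :: behead s) +
                 (c e (0 :: behead s) + d e (0 :: behead s)) + 3)%N.
(* The product has error at most [bnd / 2 ^ prec], and [bnd <= 2 ^ bnd] brings this below
   [2 ^ - (m + 1)]. *)
pose prec e s := (nth 0 s 0 + 1 + bnd e s)%N.
have hp : computable n.+1 prec.
  have h0 := computable_const oracle par n.+1 0.
  by rewrite /prec /bnd; computability; apply: (computable_prec _ h0).
have [hpa hpb] := (computable_prec ha hp, computable_prec hb hp).
have [hpc hpd] := (computable_prec hc hp, computable_prec hd hp).
apply: (@computable_fun_round _ _
  (fun e s => a e (prec e s :: behead s) * c e (prec e s :: behead s) +
              b e (prec e s :: behead s) * d e (prec e s :: behead s))%N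
  (fun e s => a e (prec e s :: behead s) * d e (prec e s :: behead s) +
              b e (prec e s :: behead s) * c e (prec e s :: behead s))%N
  (fun e s => 2 ^ (prec e s + prec e s))%N).
- by computability.
- by computability.
- by computability.
move=> e s m ss /=; split; first by rewrite expn_gt0.
have hx := hX e s (prec e (m :: s)) ss; have hy := hY e s (prec e (m :: s)) ss.
have T1 : 1 <= 2 ^+ prec e (m :: s) :> R by rewrite exprn_ege1 // ler1n.
have hB : `|X e s| + `|Y e s| + 1 <= (bnd e (m :: s))%:R.
  have := hX e s 0%N ss; have := hY e s 0%N ss.
  rewrite /bnd /= !expr0 !mul1r !natrD.
  have : 0 <= (a e (0%N :: s))%:R :> R by [].
  have : 0 <= (b e (0%N :: s))%:R :> R by [].
  have : 0 <= (c e (0%N :: s))%:R :> R by [].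
  have : 0 <= (d e (0%N :: s))%:R :> R by [].
  rewrite !ler_norml => ? ? ? ? /andP[? ?] /andP[? ?].
  have : `|X e s| <= (a e (0%N :: s))%:R + (b e (0%N :: s))%:R + 1.
    by rewrite ler_norml; apply/andP; split; lra.
  have : `|Y e s| <= (c e (0%N :: s))%:R + (d e (0%N :: s))%:R + 1.
    by rewrite ler_norml; apply/andP; split; lra.
  by lra.
rewrite [(2 ^ _)%:R]natrX exprD !natrD !natrM.
have H := approx_mul T1 hx hy hB.
have TE : 2 ^+ prec e (m :: s) = 2 ^+ m.+1 * 2 ^+ bnd e (m :: s) :> R.
  by rewrite /prec /= addn1 exprD.
have B2 := natr_le_exp2 (bnd e (m :: s)).
move: H; move: (a e (prec _ _ :: _))%:R (b e (prec _ _ :: _))%:R.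
move: (c e (prec _ _ :: _))%:R (d e (prec _ _ :: _))%:R => C D A B.
have -> : A * C + B * D - (A * D + B * C) = (A - B) * (C - D) by ring.
move=> H; apply: (@le_trans _ _ (2 ^+ prec e (m :: s) * (bnd e (m :: s))%:R * 2 ^+ m.+1)).
  by rewrite ler_wpM2r // exprn_ge0.
rewrite -mulrA ler_wpM2l ?exprn_ge0 //.
by rewrite [leRHS]TE mulrC ler_wpM2l ?exprn_ge0.
Qed.

Lemma computable_fun_sum n X N : computable n N -> computable_fun n.+1 X ->
  computable_fun n (fun e s => \sum_(i < N e s) X e (val i :: s)).
Proof.
move=> hN [a [b [ha hb hX]]].
(* The [N] unit errors total at most [2 ^ N], absorbed by [N] more bits of precision. *)
pose prec e s := (nth 0 s 0 + 1 + N e (behead s))%N.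
have hp : computable n.+1 prec by rewrite /prec; computability.
have hsum c : computable n.+2 c ->
    computable n.+1 (fun e s =>
      \sum_(i < N e (behead s)) c e [:: prec e s, val i & behead s])%N.
  move=> hc; apply: (@computable_sum _ _ _ _
    (fun e s => c e [:: prec e (behead s), nth 0 s 0 & behead (behead s)])%N).
    by computability.
  apply: (@computable_env _ _ _ 2 n c
    [:: fun e s => prec e (behead s); fun _ s => nth 0 s 0])%N => //.
  split; first exact: computable_behead.
  by split=> //; exact: computable_var.
apply: (computable_fun_round (hsum _ ha) (hsum _ hb) (d := fun e s => 2 ^ prec e s)%N).
  by computability.
move=> e s m ss /=; split; first by rewrite expn_gt0.
rewrite natrX !natr_sum mulr_sumr -!sumrB.
have TE : 2 ^+ prec e (m :: s) = 2 ^+ N e s * 2 ^+ m.+1 :> R.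
  by rewrite /prec /= addn1 exprD mulrC.
rewrite [leRHS]TE ler_pM2r ?exprn_gt0 //.
apply: le_trans (natr_le_exp2 _); rewrite -[N e s in leRHS]card_ord -sum1_card natr_sum.
apply: le_trans (ler_norm_sum _ _ _) _; apply: ler_sum => i _.
by apply: hX; rewrite /= ss.
Qed.

(** [z] is a candidate for [2 ^ m * X] and [w] a working precision at which the test [P] certifies
    it. Completeness makes the search end; soundness makes whatever it finds acceptable. *)
Lemma computable_fun_search n X (P : E -> seq nat -> bool) :
  computable n.+3 (fun e s => P e s) ->
  (forall e s m, size s = n -> exists z w, P e [:: w, z, m & s]) ->
  (forall e s m z w, size s = n -> P e [:: w, z, m & s] ->
     z%:R - 1 <= 2 ^+ m * X e s <= z%:R + 1) ->
  computable_fun n X.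
Proof.
move=> hP exP Psound; have [|g hg Pg] := computable_search hP.
  by move=> e [|m s] //= [ss]; exact: exP.
exists g, (fun _ _ => 0%N); split=> // [|e s m ss]; first exact: computable_const.
have [|w Pw] := Pg e (m :: s); first by rewrite /= ss.
have /andP[? ?] := Psound _ _ _ _ _ ss Pw.
by rewrite ler_norml; apply/andP; split; lra.
Qed.

Lemma exp2_unbounded (B : R) : exists w : nat, B <= 2 ^+ w.
Proof.
by exists (Num.bound B); apply/ltW/upper_nthrootP.
Qed.

Lemma nat_floor (x : R) : 0 <= x -> exists z : nat, z%:R <= x < z%:R + 1.
Proof.
by move=> x0; exists (Num.truncn x); rewrite natr1 truncn_itv.
Qed.

(** With [x] within 1 of [2 ^ w * X], the test says [(z - 1) * (x + 1) <= 2 ^ (m + w) <= (z + 1) *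
    (x - 1)], which encloses [2 ^ m / X] between [z - 1] and [z + 1]. The term [x + 1] is moved to
    the right to avoid truncated subtraction. *)
Lemma computable_fun_inv n X : (forall e s, size s = n -> 0 < X e s) ->
  computable_fun n X -> computable_fun n (fun e s => (X e s)^-1).
Proof.
move=> X0 [a [b [ha hb hX]]].
pose x e s := (a e (nth 0 s 0 :: behead (behead (behead s))) -
               b e (nth 0 s 0 :: behead (behead (behead s))))%N.
have hx : computable n.+3 x.
  have hv : computable (3 + n) (fun _ s => nth 0%N s 0) by computability.
  by apply: computable_sub; [apply: (@computable_env _ _ _ 3 n a [:: _])
    | apply: (@computable_env _ _ _ 3 n b [:: _])].
apply: (@computable_fun_search _ _ (fun e s => [&& 1 < x e s,
    nth 0 s 1 * (x e s).+1 <= 2 ^ (nth 0 s 2 + nth 0 s 0) + (x e s).+1 &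
    2 ^ (nth 0 s 2 + nth 0 s 0) <= (nth 0 s 1).+1 * (x e s).-1])%N).
- by computability.
- move=> e s m ss; have x0 := X0 e s ss.
  have [|z /andP[z1 z2]] := @nat_floor (2 ^+ m / X e s).
    by rewrite divr_ge0 ?exprn_ge0 // ltW.
  rewrite ler_pdivlMr // in z1; rewrite ltr_pdivrMr // in z2.
  (* The floor leaves the strict gap [dl]; [w] is so large that [2 ^ w * dl] and [2 ^ w * X]
     outweigh the rounding terms [2 * (z + 1)] and [3 + 2 * z]. *)
  pose dl := (z%:R + 1) * X e s - 2 ^+ m.
  have dl0 : 0 < dl by rewrite subr_gt0.
  have [w hw] := exp2_unbounded (3 / X e s + 2 * z%:R / X e s + 2 * (z%:R + 1) / dl).
  have z0 : 0 <= z%:R :> R by [].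
  have w1 : 3 + 2 * z%:R <= 2 ^+ w * X e s.
    rewrite -ler_pdivrMr // mulrDl; apply: le_trans hw.
    by rewrite lerDl divr_ge0 ?(ltW dl0) // mulr_ge0 // addr_ge0.
  have w2 : 2 * (z%:R + 1) <= 2 ^+ w * dl.
    rewrite -ler_pdivrMr //; apply: le_trans hw; rewrite lerDr.
    by rewrite addr_ge0 // divr_ge0 ?(ltW x0) // mulr_ge0.
  exists z, w; rewrite /x /=; have := hX e s w ss.
  move: (a e _) (b e _) => A B; rewrite ler_norml => /andP[l1 l2].
  have BA : (B.+1 < A)%N by rewrite -(ltr_nat R) -natr1; lra.
  have AB : (A - B)%:R = A%:R - B%:R :> R by rewrite natrB // ltnW // ltnW.
  apply/and3P; split.
  + by rewrite -(ltr_nat R) AB; lra.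
  + rewrite -(ler_nat R) natrM natrD natrX exprD -[(A - B).+1%:R]natr1 AB.
    have W0 : 0 <= 2 ^+ w :> R by rewrite exprn_ge0.
    move: (2 ^+ m) (2 ^+ w) (X e s) z%:R (A%:R - B%:R)
      z0 W0 z1 w1 l1 l2 {hw w2 z2 dl0 dl AB x0}.
    move=> M W y Z D z0 W0 z1 w1 l1 l2.
    have : 0 <= Z * (W * y + 1 - D) by rewrite mulr_ge0 //; lra.
    have : 0 <= W * (M - Z * y) by rewrite mulr_ge0 //; lra.
    by lra.
  + rewrite -(ler_nat R) natrM natrX exprD -[z.+1%:R]natr1 -subn1 natrB ?AB; last first.
      by rewrite subn_gt0 ltnW.
    have W0 : 0 <= 2 ^+ w :> R by rewrite exprn_ge0.
    rewrite /dl in w2.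
    move: (2 ^+ m) (2 ^+ w) (X e s) z%:R (A%:R - B%:R)
      z0 W0 w2 l1 {hw w1 l2 z1 z2 dl0 dl AB x0}.
    move=> M W y Z D z0 W0 w2 l1.
    have : 0 <= (Z + 1) * (D - 1 - (W * y - 2)) by rewrite mulr_ge0 //; lra.
    by lra.
- move=> e s m z w ss; have x0 := X0 e s ss; rewrite /x /=.
  have := hX e s w ss; move: (a e _) (b e _) => A B.
  rewrite ler_norml => /andP[l1 l2] /and3P[BA].
  have {}BA : (B.+1 < A)%N by rewrite ltn_subRL addn1 in BA.
  have AB : (A - B)%:R = A%:R - B%:R :> R by rewrite natrB // ltnW // ltnW.
  rewrite -!(ler_nat R) !natrM natrD natrX exprD -[z.+1%:R]natr1
    -[(A - B).+1%:R]natr1 AB -subn1 natrB ?AB; last first.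
    by rewrite subn_gt0 ltnW.
  have W0 : 0 < 2 ^+ w :> R by rewrite exprn_gt0.
  have M0 : 0 < 2 ^+ m :> R by rewrite exprn_gt0.
  have {}BA : B%:R + 1 < A%:R :> R by rewrite natr1 ltr_nat.
  have Z0 : 0 <= z%:R :> R by [].
  rewrite ler_pdivlMr // ler_pdivrMr //.
  move: (2 ^+ m) (2 ^+ w) (X e s) z%:R W0 M0 Z0 x0 l1 l2.
  move=> M W y Z W0 M0 Z0 x0 l1 l2 h1 h2.
  apply/andP; split; last first.
    rewrite -(ler_pM2l W0).
    have : 0 <= (Z + 1) * (W * y + 1 - (A%:R - B%:R)) by rewrite mulr_ge0 //; lra.
    by lra.
  have [z1|z1] := leP Z 1.
    by apply: (@le_trans _ _ 0); rewrite ?(ltW M0) // pmulr_lle0 // subr_le0.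
  rewrite -(ler_pM2l W0).
  have : 0 <= (Z - 1) * (A%:R - B%:R + 1 - W * y) by rewrite mulr_ge0 //; lra.
  by lra.
Qed.

(** Raising to the power [2 ^ w] makes the exponent the integer [y], and the factor [2 ^ (w * y)]
    clears the denominator. *)
Lemma powR_testE (c x y w m : nat) :
  let r : R := 2 ^+ m * (x%:R / 2 ^+ w) `^ (y%:R / 2 ^+ w) in
  ((c ^ 2 ^ w * 2 ^ (w * y) <= x ^ y * 2 ^ (m * 2 ^ w))%N = (c%:R <= r)) *
  ((x ^ y * 2 ^ (m * 2 ^ w) <= c ^ 2 ^ w * 2 ^ (w * y))%N = (r <= c%:R)).
Proof.
move=> r; have W0 : 0 < 2 ^+ w :> R by rewrite exprn_gt0.
have r0 : 0 <= r by rewrite mulr_ge0 ?powR_ge0 ?exprn_ge0.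
have N0 : (0 < 2 ^ w)%N by rewrite expn_gt0.
have Y0 : 0 < 2 ^+ (w * y) :> R by rewrite exprn_gt0.
have rE : r ^+ (2 ^ w) * 2 ^+ (w * y) = x%:R ^+ y * 2 ^+ (m * 2 ^ w).
  rewrite exprMn -exprM -[(_ `^ _) ^+ _]powR_mulrn ?powR_ge0 // -powRrM natrX divfK ?gt_eqF //.
  rewrite powR_mulrn ?divr_ge0 ?exprn_ge0 // expr_div_n -exprM.
  by rewrite -mulrA divfK ?gt_eqF // mulrC.
by split; rewrite -(ler_nat R) !natrM !natrX -rE ler_pM2r // ler_pXn2r ?nnegrE.
Qed.

Lemma cvg_dyadic (d : nat -> R) (C x : R) : (forall w, `|d w - 2 ^+ w * x| <= C) ->
  (fun w => d w / 2 ^+ w) @ \oo --> x.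
Proof.
move=> hd; apply/cvgrPdist_le => eps eps0.
have [w0 hw0] := exp2_unbounded (C / eps).
exists w0 => // w /= le_w; have W0 : 0 < 2 ^+ w :> R by rewrite exprn_gt0.
rewrite distrC -(ler_pM2r W0) -[X in `|_| * X]gtr0_norm // -normrM mulrBl divfK ?gt_eqF //.
rewrite [x * _]mulrC; apply: le_trans (hd w) _; rewrite -ler_pdivrMl // mulrC.
by apply: le_trans hw0 _; rewrite ler_weXn2l // ler1n.
Qed.

Lemma cvg_powR (u v : nat -> R) (x y : R) : 0 < x ->
  u @ \oo --> x -> v @ \oo --> y -> (fun w => u w `^ v w) @ \oo --> x `^ y.
Proof.
move=> x0 ux vy; apply: (@cvg_trans _ ((fun w => expR (v w * ln (u w))) @ \oo)).
  apply: near_eq_cvg; near=> w; rewrite /powR gt_eqF //.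
  by near: w; apply: (cvgr_gt x ux).
rewrite /powR gt_eqF //; apply: continuous_cvg; first exact: continuous_expR.
by apply: cvgM => //; apply: continuous_cvg => //; exact: continuous_ln.
Unshelve. all: by end_near. Qed.

(** Monotonicity in the exponent reverses at base 1, hence the minimum and the maximum. *)
Lemma powR_between (x y1 y y2 : R) : 0 < x -> y1 <= y <= y2 ->
  Num.min (x `^ y1) (x `^ y2) <= x `^ y <= Num.max (x `^ y1) (x `^ y2).
Proof.
move=> x0 /andP[le1 le2]; rewrite ge_min le_max; have [x1|/ltW x1] := leP x 1.
  have x01 : 0 < x <= 1 by rewrite x0.
  by rewrite (ger_powR x01 le1) (ger_powR x01 le2) orbT.
by rewrite (ler_powR x1 le1) (ler_powR x1 le2) orbT.
Qed.

Lemma natr_pred_succ (A B : nat) : (B%:R + 1 < A%:R :> R) = (1 < A - B)%N /\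
  ((1 < A - B)%N -> ((A - B).-1%:R = A%:R - B%:R - 1 :> R) /\
                    ((A - B).+1%:R = A%:R - B%:R + 1 :> R)).
Proof.
split=> [|BA]; first by rewrite natr1 ltr_nat ltn_subRL addn1.
have le_BA : (B <= A)%N by rewrite ltnW // ltnW // -addn1 -ltn_subRL.
by split; [rewrite -subn1 natrB ?(ltnW BA) // natrB | rewrite -natr1 natrB].
Qed.

(** The test checks the four corners of a box of half-width [2 ^ - w] around dyadic approximations
    of [X] and [Y]. The power is monotone in each variable, so the corners enclose its value; by
    continuity they all pass for large [w]. *)
Lemma computable_fun_powR n X Y : (forall e s, size s = n -> 0 < X e s) ->
  (forall e s, size s = n -> 0 < Y e s) ->
  computable_fun n X -> computable_fun n Y ->
  computable_fun n (fun e s => X e s `^ Y e s).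
Proof.
move=> X0 Y0 [a [b [ha hb hX]]] [c [d [hc hd hY]]].
pose x e s := (a e (nth 0 s 0 :: behead (behead (behead s))) -
               b e (nth 0 s 0 :: behead (behead (behead s))))%N.
pose y e s := (c e (nth 0 s 0 :: behead (behead (behead s))) -
               d e (nth 0 s 0 :: behead (behead (behead s))))%N.
have hv : computable (3 + n) (fun _ s => nth 0%N s 0) by computability.
have hx : computable n.+3 x.
  by apply: computable_sub; [apply: (@computable_env _ _ _ 3 n a [:: _])
    | apply: (@computable_env _ _ _ 3 n b [:: _])].
have hy : computable n.+3 y.
  by apply: computable_sub; [apply: (@computable_env _ _ _ 3 n c [:: _])
    | apply: (@computable_env _ _ _ 3 n d [:: _])].
pose T w z m u v := ((z.-1 ^ 2 ^ w * 2 ^ (w * v) <= u ^ v * 2 ^ (m * 2 ^ w)) &&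
  (u ^ v * 2 ^ (m * 2 ^ w) <= z.+1 ^ 2 ^ w * 2 ^ (w * v)))%N.
have TE w z m u v : T w z m u v =
    (z.-1%:R <= 2 ^+ m * (u%:R / 2 ^+ w : R) `^ (v%:R / 2 ^+ w) <= z.+1%:R).
  by rewrite /T !powR_testE.
have hT (u v : E -> seq nat -> nat) : computable n.+3 u -> computable n.+3 v ->
    computable n.+3 (fun e s => T (nth 0 s 0) (nth 0 s 1) (nth 0 s 2) (u e s) (v e s))%N.
  by move=> hu hw; rewrite /T; computability.
pose Tu e s u v := T (nth 0 s 0)%N (nth 0 s 1)%N (nth 0 s 2)%N (u (x e s)) (v (y e s)).
apply: (@computable_fun_search _ _ (fun e s => [&& 1 < x e s, 1 < y e s,
    Tu e s predn predn, Tu e s predn succn, Tu e s succn predn &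
    Tu e s succn succn]))%N.
- by repeat (apply: computable_and || apply: hT); computability.
- move=> e s m ss; have x0 := X0 e s ss; have y0 := Y0 e s ss.
  set Z := X e s `^ Y e s; have Z0 : 0 < Z by rewrite powR_gt0.
  have r0 : 0 < 2 ^+ m * Z by rewrite mulr_gt0 ?exprn_gt0.
  have [z /andP[z1 z2]] := nat_floor (ltW r0); exists z.
  (* Strictness leaves room for the limit; for [z = 0] the predecessor is again 0 and
     [2 ^ m * Z > 0] gives it. *)
  have {}z1 : z.-1%:R < 2 ^+ m * Z.
    by case: (z) z1 => //= z' h; apply: lt_le_trans h; rewrite ltr_nat.
  rewrite natr1 in z2.
  (* Coordinates of the corners: [t = -1] and [t = 1] are the two ends of a side and have the same
     limit. *)
  pose u (t : R) w := ((a e (w :: s))%:R - (b e (w :: s))%:R + t) / 2 ^+ w.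
  pose v (t : R) w := ((c e (w :: s))%:R - (d e (w :: s))%:R + t) / 2 ^+ w.
  have cu t : u t @ \oo --> X e s.
    apply: (@cvg_dyadic _ (1 + `|t|)) => w; rewrite addrAC.
    by apply: le_trans (ler_normD _ _) _; rewrite lerD2r hX.
  have cv t : v t @ \oo --> Y e s.
    apply: (@cvg_dyadic _ (1 + `|t|)) => w; rewrite addrAC.
    by apply: le_trans (ler_normD _ _) _; rewrite lerD2r hY.
  have cr t t' : (fun w => 2 ^+ m * u t w `^ v t' w) @ \oo --> 2 ^+ m * Z.
    by apply: cvgM; [exact: cvg_cst | exact: cvg_powR].

  have box t t' : \forall w \near \oo,
      z.-1%:R <= 2 ^+ m * u t w `^ v t' w <= z.+1%:R.
    near=> w'; rewrite !ltW //; near: w'; first exact: (cvgr_lt _ (cr _ _)).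
    exact: (cvgr_gt _ (cr _ _)).
  near \oo => w.
  have u0 : 0 < u (-1) w by near: w; exact: (cvgr_gt _ (cu _)).
  have v0 : 0 < v (-1) w by near: w; exact: (cvgr_gt _ (cv _)).
  have b1 : z.-1%:R <= 2 ^+ m * u (-1) w `^ v (-1) w <= z.+1%:R.
    by near: w; exact: box.
  have b2 : z.-1%:R <= 2 ^+ m * u (-1) w `^ v 1 w <= z.+1%:R.
    by near: w; exact: box.
  have b3 : z.-1%:R <= 2 ^+ m * u 1 w `^ v (-1) w <= z.+1%:R.
    by near: w; exact: box.
  have b4 : z.-1%:R <= 2 ^+ m * u 1 w `^ v 1 w <= z.+1%:R.
    by near: w; exact: box.
  exists w; rewrite /Tu !TE /x /y /=.
  have W0 : 0 < (2 ^+ w)^-1 :> R by rewrite invr_gt0 exprn_gt0.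
  move: u0 v0 b1 b2 b3 b4; rewrite /u /v.
  rewrite !(pmulr_lgt0 _ W0) !subr_gt0 !ltrBrDl.
  move: (a e _) (b e _) (c e _) (d e _) => A B C D.
  have [-> hAB] := natr_pred_succ A B; have [-> hCD] := natr_pred_succ C D.
  move=> AB CD; have [-> ->] := hAB AB; have [-> ->] := hCD CD.
  by move=> -> -> -> ->; rewrite AB CD.
- move=> e s m z w ss; have x0 := X0 e s ss; have y0 := Y0 e s ss.
  rewrite /Tu !TE /x /y /=.
  have := hX e s w ss; have := hY e s w ss.
  move: (a e _) (b e _) (c e _) (d e _) => A B C D.
  have [_ hAB] := natr_pred_succ A B; have [_ hCD] := natr_pred_succ C D.
  rewrite !ler_norml => /andP[l3 l4] /andP[l1 l2] /and3P[AB CD].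
  have W0 : 0 < 2 ^+ w :> R by rewrite exprn_gt0.
  have M0 : 0 < 2 ^+ m :> R by rewrite exprn_gt0.
  have u0 : 0 < (A - B).-1%:R / 2 ^+ w :> R.
    by rewrite divr_gt0 // ltr0n -subn1 subn_gt0.
  have u0' : 0 < (A - B).+1%:R / 2 ^+ w :> R by rewrite divr_gt0.
  have u1 : (A - B).-1%:R / 2 ^+ w <= X e s.
    by rewrite ler_pdivrMr // (hAB AB).1; lra.
  have u2 : X e s <= (A - B).+1%:R / 2 ^+ w.
    by rewrite ler_pdivlMr // (hAB AB).2; lra.
  have v12 : (C - D).-1%:R / 2 ^+ w <= Y e s <= (C - D).+1%:R / 2 ^+ w.
    by rewrite ler_pdivrMr // ler_pdivlMr // (hCD CD).1 (hCD CD).2; apply/andP; split; lra.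
  have /andP[p1 _] := powR_between u0 v12.
  have /andP[_ p2] := powR_between u0' v12.
  (* The corners with the smaller base give the lower bound, those with the larger base the upper
     one, since [Y > 0]. *)
  move=> /and4P[/andP[c1 _] /andP[c2 _] /andP[_ c3] /andP[_ c4]].
  have mono (t t' : R) : 0 < t -> t <= t' -> t `^ Y e s <= t' `^ Y e s.
    move=> t0 tt'; have t0' := lt_le_trans t0 tt'.
    by apply: ge0_ler_powR; rewrite ?nnegrE ?(ltW y0) ?(ltW t0) ?(ltW t0').
  have z1 : z%:R - 1 <= z.-1%:R :> R by case: z {c1 c2 c3 c4} => [|z] /=; rewrite -?natr1; lra.
  apply/andP; split.
    apply: le_trans z1 _; rewrite mulrC -ler_pdivrMr //.
    apply: le_trans (mono _ _ u0 u1); apply: le_trans p1.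
    by rewrite le_min !ler_pdivrMr // ![_ * 2 ^+ m]mulrC c1.
  rewrite natr1 mulrC -ler_pdivlMr //.
  apply: le_trans (mono _ _ x0 u2) _; apply: le_trans p2 _.
  by rewrite ge_max !ler_pdivlMr // ![_ * 2 ^+ m]mulrC c3.
Unshelve. all: by end_near. Qed.

End ComputableReals.

(** * Computing the parallelepiped *)

Lemma int_of_codeE (R : pzRingType) (y : nat) : (int_of_code y)%:~R =
  (~~ odd y * (y %/ 2))%:R - (odd y * (y %/ 2).+1)%:R :> R.
Proof.
rewrite /int_of_code divn2; case: (odd y); rewrite /= ?mul0n ?mul1n ?subr0 //.
by rewrite NegzE mulrNz sub0r.
Qed.

(** A natural number [n] has the code [2 * n], and [- n] with [n > 0] the code [2 * n - 1]; one of
    the two truncated differences is 0 and adds nothing. *)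
Lemma int_of_code_sub (R : pzRingType) (a b : nat) :
  (int_of_code (2 * (a - b) + (2 * (b - a)).-1))%:~R = a%:R - b%:R :> R.
Proof.
have [le_ba|lt_ab] := leqP b a.
  have -> : (b - a = 0)%N by apply/eqP; rewrite subn_eq0.
  by rewrite /int_of_code muln0 addn0 mul2n odd_double doubleK -natrB.
have -> : (a - b = 0)%N by apply/eqP; rewrite subn_eq0 ltnW.
have [d bE] : exists d, (b - a = d.+1)%N by exists (b - a).-1; rewrite prednK ?subn_gt0.
rewrite bE /int_of_code muln0 add0n mulnS /= mul2n odd_double /= uphalf_double.
by rewrite NegzE mulrNz -bE -[RHS]opprB -natrB // ltnW.
Qed.

Section Algorithm.
Variable R : realType.

(** The index type over which the program is uniform. Carrying the hypotheses makes positivity and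
    nonvanishing available at every input. *)
Record instance := Instance {
  inst_oracle : nat -> nat;
  inst_p : R;
  inst_k : nat;
  inst_p_ge1 : 1 <= inst_p;
  inst_p_cond : inst_p \isn't a Num.int \/ inst_k%:R <= inst_p;
  inst_names : names inst_oracle inst_p }.

Local Notation computable := (computable inst_oracle inst_k).
Local Notation computable_fun := (@computable_fun R _ inst_oracle inst_k).
Implicit Types (f g : instance -> seq nat -> nat).

Lemma computable_bit n f g : computable n f -> computable n g ->
  computable n (fun e s => bit (f e s) (g e s)).
Proof. by move=> hf hg; rewrite /bit; computability. Qed.

Lemma computable_weight n f : computable n f ->
  computable n (fun e s => weight (inst_k e) (f e s)).
Proof.
move=> hf; apply: (@computable_sum _ _ _ n
  (fun e s => bit (f e (behead s)) (nth 0 s 0))%N (fun e _ => inst_k e)).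
  exact: computable_par.
by apply: computable_bit; computability.
Qed.

Lemma computable_dot n f g : computable n f -> computable n g ->
  computable n (fun e s => dot (inst_k e) (f e s) (bit (g e s))).
Proof.
move=> hf hg; apply: (@computable_sum _ _ _ n
  (fun e s => bit (f e (behead s)) (nth 0 s 0) && bit (g e (behead s)) (nth 0 s 0))%N
  (fun e _ => inst_k e)).
  exact: computable_par.
by apply: computable_and; apply: computable_bit; computability.
Qed.

Lemma computable_fun_p n : computable_fun n (fun e _ => inst_p e).
Proof.
exists (fun e s => ~~ odd (inst_oracle e (nth 0 s 0)) * (inst_oracle e (nth 0 s 0) %/ 2))%N.
exists (fun e s => odd (inst_oracle e (nth 0 s 0)) * (inst_oracle e (nth 0 s 0) %/ 2).+1)%N.
split; [by computability | by computability |] => e s m _ /=.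
have := inst_names e m; rewrite /approximates int_of_codeE.
have M0 : 0 < 2 ^+ m :> R by rewrite exprn_gt0.
rewrite -[X in _ <= X]mul1r ler_pdivlMr // -[X in `|_| * X]gtr0_norm // -normrM.
by rewrite mulrBl divfK ?gt_eqF // [inst_p e * _]mulrC.
Qed.

Lemma computable_fun_sign n f : computable n f ->
  computable_fun n (fun e s => (-1) ^+ f e s).
Proof.
move=> hf; apply: (@eq_computable_fun _ _ _ _ _
  (fun e s => (~~ odd (f e s))%:R + - (odd (f e s))%:R)).
  by move=> e s _; rewrite -signr_odd; case: (odd _); rewrite ?sub0r ?subr0.
apply: computable_fun_add; last apply: computable_fun_opp;
  by apply: computable_fun_nat; computability.
Qed.

Lemma computable_fun_eigen n f : computable n f ->
  computable_fun n (fun e s => eigen (inst_p e) (inst_k e) (f e s)).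
Proof.
move=> hf; apply: (@computable_fun_sum _ _ _ _ n (fun e s =>
    (-1) ^+ dot (inst_k e) (f e (behead s)) (bit (nth 0 s 0)%N) *
    (1 + 2 * weight (inst_k e) (nth 0 s 0)%N)%:R `^ inst_p e)
  (fun e _ => 2 ^ inst_k e)%N).
  by computability.
apply: computable_fun_mul.
  by apply/computable_fun_sign/computable_dot; computability.
apply: computable_fun_powR.
- by move=> e s _; rewrite ltr0n.
- by move=> e s _; rewrite (lt_le_trans ltr01) ?inst_p_ge1.
- apply: computable_fun_nat; computability.
  by apply: computable_weight; computability.
- exact: computable_fun_p.
Qed.

(** Eigenvalues may be negative while inversion is available for positive functions, so the inverse
    is written [u * (u * u)^-1]. *)
Lemma computable_fun_eigenV n f : computable n f ->
  computable_fun n (fun e s => (eigen (inst_p e) (inst_k e) (f e s))^-1).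
Proof.
move=> hf; have hE := computable_fun_eigen hf.
apply: (@eq_computable_fun _ _ _ _ _ (fun e s =>
  eigen (inst_p e) (inst_k e) (f e s) *
  (eigen (inst_p e) (inst_k e) (f e s) * eigen (inst_p e) (inst_k e) (f e s))^-1)).
  move=> e s _; have := eigen_neq0 (inst_p_cond e) (f e s).
  by move=> nz; rewrite invfM mulrA divff ?mul1r.
apply: computable_fun_mul => //; apply: computable_fun_inv.
  move=> e s _; have := eigen_neq0 (inst_p_cond e) (f e s).
  by rewrite -expr2 exprn_even_gt0.
exact: computable_fun_mul.
Qed.

Lemma computable_fun_eigen_bound n :
  computable_fun n (fun e _ => eigen_bound (inst_p e) (inst_k e)).
Proof.
have h1 i : computable_fun i (fun _ _ => 1).
  by apply: (@computable_fun_nat _ _ _ _ i (fun _ _ => 1%N)); computability.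
apply: computable_fun_add => //.
apply: (@computable_fun_sum _ _ _ _ n
  (fun e s => 1 + (eigen (inst_p e) (inst_k e) (nth 0 s 0)%N)^-1 ^+ 2)
  (fun e _ => 2 ^ inst_k e)%N).
  by computability.
apply: computable_fun_add => //.
by apply: computable_fun_mul; apply: computable_fun_eigenV; computability.
Qed.

Lemma computable_fun_row_coef n f : computable n f ->
  computable_fun n (fun e s => row_coef (inst_p e) (inst_k e) (f e s)).
Proof.
move=> hf; apply: computable_fun_mul.
  apply: computable_fun_add; first exact: computable_fun_eigen_bound.
  apply: (@computable_fun_sum _ _ _ _ n (fun e s =>
      (-1) ^+ dot (inst_k e) (nth 0 s 0)%N (bit (f e (behead s))) *
      (eigen (inst_p e) (inst_k e) (nth 0 s 0)%N)^-1)
    (fun e _ => 2 ^ inst_k e)%N).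
    by computability.
  apply: computable_fun_mul; last by apply: computable_fun_eigenV; computability.
  by apply/computable_fun_sign/computable_dot; computability.
apply: computable_fun_inv => [e s _|].
  by rewrite mulr_gt0 ?eigen_bound_gt0 ?eigen0_gt0 //; exact: inst_p_cond.
apply: computable_fun_mul; last exact: computable_fun_eigen_bound.
by apply: (@computable_fun_eigen n (fun _ _ => 0%N)); computability.
Qed.

Lemma computable_fun_entry n f g : computable n f -> computable n g ->
  computable_fun n (fun e s => entry (inst_p e) (inst_k e) (f e s) (g e s)).
Proof.
move=> hf hg; have hbit := computable_bit hf hg; have hw := computable_weight hf.
apply: computable_fun_mul.
  apply: computable_fun_add; last apply: computable_fun_opp;
    by apply: computable_fun_nat; computability.
apply: computable_fun_powR.
- by move=> e s _; apply: row_coef_gt0; exact: inst_p_cond.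
- by move=> e s _; rewrite invr_gt0 (lt_le_trans ltr01) ?inst_p_ge1.
- exact: computable_fun_row_coef.
apply: computable_fun_inv; last exact: computable_fun_p.
by move=> e s _; rewrite (lt_le_trans ltr01) ?inst_p_ge1.
Qed.

Lemma entry_algorithm : exists c : prog, forall (e : instance) (i j prec : nat),
  exists y, Defs.eval (inst_oracle e) c [:: inst_k e; i; j; prec] y /\
    approximates prec y (entry (inst_p e) (inst_k e) i j).
Proof.
have hv i : (i < 2)%N -> computable 2 (fun _ s => nth 0 s i)%N.
  by move=> ?; exact: computable_var.
have [a [b [ha hb hX]]] := computable_fun_entry (hv 0%N isT) (hv 1%N isT).
have [c hc] : computable 3 (fun e s => 2 * (a e s - b e s) + (2 * (b e s - a e s)).-1)%N.
  by computability.
(* The arguments arrive as [k, i, j, prec]; the inner program expects the variables [prec, i, j] and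
   then the parameter [k]. *)
exists (PComp c [:: PProj 3; PProj 1; PProj 2; PProj 0]) => e i j prec.
exists (2 * (a e [:: prec; i; j] - b e [:: prec; i; j]) +
        (2 * (b e [:: prec; i; j] - a e [:: prec; i; j])).-1)%N; split.
  apply: EvalComp (hc e [:: prec; i; j] erefl).
  by do 4![apply: EvalCons; first exact: EvalProj]; exact: EvalNil.
rewrite /approximates int_of_code_sub; have := hX e [:: i; j] prec erefl => /=.
have M0 : 0 < 2 ^+ prec :> R by rewrite exprn_gt0.
rewrite -[X in _ <= X -> _]mul1r -[X in _ -> _ <= X]mul1r ler_pdivlMr //.
rewrite -[X in _ -> `|_| * X <= _]gtr0_norm // -normrM mulrBl divfK ?gt_eqF //.
by rewrite mul1r [_ * 2 ^+ prec]mulrC.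
Qed.

End Algorithm.

Theorem theorem3p1 (R : realType) :
  (forall (k : nat) (p : R),
     (0 < k)%N -> 1 <= p -> p \isn't a Num.int \/ k%:R <= p ->
     exists (V : 'M[R]_(2 ^ k, k)) (t : 'cV[R]_(2 ^ k)),
       isolating_parallelepiped p V t)
  /\
  (exists c : prog,
     forall (k : nat) (p : R),
       (0 < k)%N -> 1 <= p -> p \isn't a Num.int \/ k%:R <= p ->
       computable_real p ->
       forall phi : nat -> nat, names phi p ->
       exists (V : 'M[R]_(2 ^ k, k)) (t : 'cV[R]_(2 ^ k)),
         isolating_parallelepiped p V t
         /\ outputs_matrix c phi k (row_mx V t)).
Proof.
split=> [k p _ p1 pk|].
  by exists (parallelepiped p k), (target p k); exact: isolating_parallelepiped_entry.
have [c hc] := entry_algorithm R; exists c => k p _ p1 pk _ phi phip.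
exists (parallelepiped p k), (target p k).
split; first exact: isolating_parallelepiped_entry.
move=> i j prec; rewrite row_mx_entry.
exact: (hc (Instance p1 pk phip) i j prec).
Qed.
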